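(* Let Problem (Rec) be a minimization problem, with input a binary tensor $\mathcal G=(g_{ijk})\in\{0,1\}^{n\times m\times l}$, in variables $(x,y,z,\mathcal W)$ with $\mathcal W=(w_{ijk})$ (possibly together with additional variables), whose objective function is $$\sum_{(i,j,k)\in S_0}w_{ijk}+\sum_{(i,j,k)\in S_1}(1-w_{ijk}),$$ and whose feasible region satisfies $0\le w_{ijk}\le1$ for all $i\in[n],j\in[m],k\in[l]$. Then Problem (Rec) is robust.
   Context: Write $[n]=\{1,\dots,n\}$. For a binary tensor $\mathcal G$, $S_0=\{(i,j,k)\in[n]\times[m]\times[l]:g_{ijk}=0\}$ and $S_1=\{(i,j,k)\in[n]\times[m]\times[l]:g_{ijk}=1\}$. Let $\bar x\in\{0,1\}^n,\bar y\in\{0,1\}^m,\bar z\in\{0,1\}^l$ and let the ground truth be the tensor $\bar{\mathcal W}=\bar x\otimes\bar y\otimes\bar z$ with entries $\bar w_{ijk}=\bar x_i\bar y_j\bar z_k$. An optimization problem recovers the ground truth for input $\mathcal G$ if it has a unique optimal solution and this solution corresponds to the ground truth, i.e., its $(x,y,z,\mathcal W)$ part equals $(\bar x,\bar y,\bar z,\bar{\mathcal W})$. A monotone transformation of $\mathcal G$ (with respect to $\bar{\mathcal W}$) reverts an entry of $\mathcal G$ that differs from the corresponding entry of $\bar{\mathcal W}$ to its value in $\bar{\mathcal W}$. An optimization problem is robust if, whenever it recovers the ground truth for an input tensor $\mathcal G$, it also recovers the ground truth for every tensor obtained from $\mathcal G$ by an arbitrary sequence of monotone transformations. *)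

(* Defs.v *)
From HB Require Import structures.
From mathcomp Require Import all_boot all_order all_algebra.
From mathcomp Require Import reals.

Set Implicit Arguments.
Unset Strict Implicit.
Unset Printing Implicit Defensive.

Import Order.TTheory GRing.Theory Num.Theory.
Local Open Scope ring_scope.

Notation tensor T n m l := {ffun 'I_n * 'I_m * 'I_l -> T}.

Definition S0 n m l (G : tensor bool n m l) : {set 'I_n * 'I_m * 'I_l} :=
  [set t | G t == false].

Definition S1 n m l (G : tensor bool n m l) : {set 'I_n * 'I_m * 'I_l} :=
  [set t | G t == true].

(* On {0,1}, encoded as bool, the product is [&&]. *)
Definition outer n m l (x : 'rV[bool]_n) (y : 'rV[bool]_m) (z : 'rV[bool]_l) :
    tensor bool n m l :=
  [ffun t => [&& x 0 t.1.1, y 0 t.1.2 & z 0 t.2]].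

(* [var_aux] collects the additional variables, if any; [U := unit] when there
   are none. *)
Record point (R : realType) (n m l : nat) (U : Type) := Point {
  var_x : 'rV[R]_n;
  var_y : 'rV[R]_m;
  var_z : 'rV[R]_l;
  var_w : tensor R n m l;
  var_aux : U
}.

(* A minimization problem taking a binary tensor as input: a priori both the
   feasible region and the objective may depend on the input. *)
Record min_problem (R : realType) (n m l : nat) (U : Type) := MinProblem {
  feasible : tensor bool n m l -> point R n m l U -> Prop;
  objective : tensor bool n m l -> point R n m l U -> R
}.

Definition optimal R n m l U (P : min_problem R n m l U)
    (G : tensor bool n m l) (p : point R n m l U) : Prop :=
  feasible P G p /\
  forall q, feasible P G q -> objective P G p <= objective P G q.

Definition corresponds R n m l U (p : point R n m l U)
    (x : 'rV[bool]_n) (y : 'rV[bool]_m) (z : 'rV[bool]_l) : Prop :=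
  [/\ var_x p = \row_i (x 0 i)%:R,
      var_y p = \row_j (y 0 j)%:R,
      var_z p = \row_k (z 0 k)%:R
    & var_w p = [ffun t => (outer x y z t)%:R]].

(* Uniqueness is that of the whole optimal solution, additional variables
   included. *)
Definition recovers R n m l U (P : min_problem R n m l U)
    (G : tensor bool n m l)
    (x : 'rV[bool]_n) (y : 'rV[bool]_m) (z : 'rV[bool]_l) : Prop :=
  exists p, unique (optimal P G) p /\ corresponds p x y z.

Definition monotone_transformation n m l (W : tensor bool n m l) :
    rel (tensor bool n m l) :=
  fun G G' => [exists t, (G t != W t) &&
    (G' == [ffun s => if s == t then W s else G s])].

(* [connect] is the reflexive transitive closure: G' is reached from G by a
   finite sequence of monotone transformations. *)
Definition robust R n m l U (P : min_problem R n m l U) : Prop :=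
  forall (x : 'rV[bool]_n) (y : 'rV[bool]_m) (z : 'rV[bool]_l)
         (G G' : tensor bool n m l),
    recovers P G x y z ->
    connect (monotone_transformation (outer x y z)) G G' ->
    recovers P G' x y z.

(* The input enters only through the objective; the feasible region F is the
   same for every input. *)
Definition Rec R n m l U (F : point R n m l U -> Prop) : min_problem R n m l U :=
  {| feasible := fun _ => F;
     objective := fun G p =>
       \sum_(t in S0 G) var_w p t + \sum_(t in S1 G) (1 - var_w p t) |}.

(* Main.v *)
Require Import Defs.
From HB Require Import structures.
From mathcomp Require Import all_boot all_order all_algebra.
From mathcomp Require Import reals lra.

Set Implicit Arguments.
Unset Strict Implicit.
Unset Printing Implicit Defensive.

Import Order.TTheory GRing.Theory Num.Theory.
Local Open Scope ring_scope.

(** The objective is a sum over the entries, the entry [t] costing the distance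
    from [w_t] to the input bit [G t].  Suppose that a monotone transformation
    reverts the entry [t], and let [W] be the ground truth.  If a feasible
    point is at distance [d] from [W t], where [0 <= d <= 1], its cost at [t]
    changes from [1 - d] to [d], whereas that of the ground truth drops from [1]
    to [0].  The gap between the objective value of the point and that of the
    ground truth thus grows by [2 * d], and in particular cannot shrink
    ([ler_gap_revert]).  The feasible region being the same for both inputs, a
    point that attains at most the value of the ground truth after the
    transformation did so before it, where the ground truth was the only
    optimum.  Hence recovery is preserved by each transformation
    ([recovers_revert]), and therefore by any sequence of them. *)

Definition entry_cost (R : realType) (b : bool) (w : R) : R :=
  if b then 1 - w else w.

Lemma objective_RecE (R : realType) n m l U (F : point R n m l U -> Prop) G p :
  objective (Rec F) G p = \sum_t entry_cost (G t) (var_w p t).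
Proof.
rewrite /= big_mkcond [X in _ + X]big_mkcond -big_split; apply: eq_bigr => t _.
by rewrite !inE /entry_cost; case: (G t); rewrite /= ?add0r ?addr0.
Qed.

(** The gap at an entry is smallest when the input bit [b] differs from the true
    bit [c]: it is then minus the distance from [w] to [c], whereas it is plus
    that distance when the two bits agree. *)
Lemma ler_entry_gap (R : realType) (b c : bool) (w : R) : 0 <= w <= 1 ->
  entry_cost b w - entry_cost b c%:R <= entry_cost c w - entry_cost c c%:R.
Proof. by case: b; case: c => /andP[w_ge0 w_le1]; rewrite /entry_cost /=; lra. Qed.

Lemma ler_gap_revert (R : realType) n m l U (F : point R n m l U -> Prop)
    (W G G' : tensor bool n m l) (p q : point R n m l U) :
    var_w p = [ffun t => (W t)%:R] ->
    (forall t, 0 <= var_w q t <= 1) ->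
    monotone_transformation W G G' ->
  objective (Rec F) G q - objective (Rec F) G p
    <= objective (Rec F) G' q - objective (Rec F) G' p.
Proof.
move=> p_W q_box /existsP[t /andP[_ /eqP->]].
rewrite !objective_RecE -!sumrB p_W; apply: ler_sum => s _.
by rewrite !ffunE; case: eqP => // _; apply: ler_entry_gap.
Qed.

Lemma recovers_revert (R : realType) n m l U (F : point R n m l U -> Prop)
    x y z (G G' : tensor bool n m l) :
    (forall p, F p -> forall t, 0 <= var_w p t <= 1) ->
    monotone_transformation (outer x y z) G G' ->
  recovers (Rec F) G x y z -> recovers (Rec F) G' x y z.
Proof.
move=> F_box GG' [p [[[Fp p_min] p_uniq] p_corr]]; exists p; split=> //.
have [_ _ _ p_W] := p_corr.
have gap q (Fq : F q) := ler_gap_revert F p_W (F_box q Fq) GG'.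
split.
  split=> // q Fq; rewrite -subr_ge0; apply: le_trans (gap q Fq).
  by rewrite subr_ge0; apply: p_min.
move=> q [Fq q_min]; apply: p_uniq; split=> // r Fr.
apply: le_trans (p_min r Fr); rewrite -subr_le0; apply: le_trans (gap q Fq) _.
by rewrite subr_le0; apply: q_min.
Qed.

Theorem proposition2 (R : realType) (n m l : nat) (U : Type)
    (F : point R n m l U -> Prop)
    (F_box : forall p, F p ->
       forall (i : 'I_n) (j : 'I_m) (k : 'I_l), 0 <= var_w p (i, j, k) <= 1) :
  robust (Rec F).
Proof.
have F_box' p : F p -> forall t, 0 <= var_w p t <= 1.
  by move=> Fp [[i j] k]; apply: F_box.
move=> x y z G G' G_rec /connectP[s].
elim: s G G_rec => [|G1 s IHs] G G_rec /= => [_ -> // | /andP[GG1 s_path]].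
exact: IHs (recovers_revert F_box' GG1 G_rec) s_path.
Qed.
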